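(* There exists an absolute constant $c>0$ such that for every $n\ge 1$ and every convex body $K\subset\mathbb{R}^n$, $$V_1(K)\ \ge\ c\,\sqrt{\frac{\log n}{n}}\,\sqrt{r_1(K)^2+\dots+r_n(K)^2},$$ where $V_1(K)$ is the first intrinsic volume of $K$ and $r_1(K),\dots,r_n(K)$ are the successive inner radii of $K$.
   Context: For a convex body $K\subset\mathbb{R}^n$ and $1\le i\le n$, the $i$-th successive inner radius is $r_i(K)=\max_{L}\, r(K\cap L)$, where the maximum is over all $i$-dimensional affine subspaces $L$ of $\mathbb{R}^n$ and $r(K\cap L)$ is the inradius of $K\cap L$ measured within $L$ (the largest radius of an $i$-dimensional Euclidean ball in $L$ contained in $K\cap L$). The first intrinsic volume is $$V_1(K)=\frac{n\,\kappa_n}{\kappa_1\,\kappa_{n-1}}\int_{\mathcal{L}_1^n}\mathrm{Vol}_1(K|L)\,d\mu_1(L),$$ where $\mathcal{L}_1^n$ is the set of all $1$-dimensional linear subspaces of $\mathbb{R}^n$ with its unique rotation-invariant (Haar) probability measure $\mu_1$, $K|L$ is the orthogonal projection of $K$ onto $L$, and $\kappa_m=\pi^{m/2}/\Gamma(1+m/2)$ is the volume of the $m$-dimensional Euclidean unit ball. (Equivalently, $V_1(K)$ is the coefficient appearing in Steiner's formula $\mathrm{Vol}(K+\lambda B^n)=\sum_{i=0}^n\lambda^{n-i}\kappa_{n-i}V_i(K)$ for $\lambda \ge 0$, where $B^n$ is the Euclidean unit ball.) *)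

(* Defs.v *)
From HB Require Import structures.
From mathcomp Require Import all_boot all_order all_algebra.
From mathcomp Require Import all_classical all_reals all_analysis.

Set Implicit Arguments.
Unset Strict Implicit.
Unset Printing Implicit Defensive.

Import Order.TTheory GRing.Theory Num.Theory.
Import numFieldNormedType.Exports.

Local Open Scope classical_set_scope.
Local Open Scope ring_scope.

(* R^d is 'rV[R]_d.  The norm `|x| that the library puts on 'rV[R]_d is the
   sup norm, so the Euclidean structure is given separately; both norms induce
   the same topology, which is the one used for compactness. *)
Definition dotp (R : realType) (d : nat) (x y : 'rV[R]_d) : R :=
  \sum_(i < d) x 0 i * y 0 i.

Definition enorm (R : realType) (d : nat) (x : 'rV[R]_d) : R :=
  Num.sqrt (dotp x x).

(* The interior may be empty. *)
Definition convex_body (R : realType) (d : nat) (K : set 'rV[R]_d) : Prop :=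
  [/\ K !=set0, compact K & convex_set (K : set (convex_lmodType 'rV[R]_d))].

Definition affine_subspace (R : realType) (d i : nat) (L : set 'rV[R]_d) :
    Prop :=
  exists (p : 'rV[R]_d) (V : {vspace 'rV[R]_d}),
    \dim V = i /\ L = [set x | x - p \in V].

(* Here and below a maximum is rendered by [sup]: for compact K and i >= 1 the
   sets involved are bounded and the maxima exist.  A subspace L missing K
   contributes [sup set0 = 0], which does not affect [inner_radius]. *)
Definition inradius (R : realType) (d : nat) (L A : set 'rV[R]_d) : R :=
  sup [set rho | 0 <= rho /\
    exists2 x, L x & [set y | L y /\ enorm (y - x) <= rho] `<=` A].

Definition inner_radius (R : realType) (d i : nat) (K : set 'rV[R]_d) : R :=
  sup [set inradius L (K `&` L) | L in affine_subspace i].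

Definition Gamma (R : realType) (x : R) : R :=
  \int[lebesgue_measure]_(t in `]0, +oo[) (t `^ (x - 1) * expR (- t)).

Definition kappa (R : realType) (m : nat) : R :=
  pi `^ (m%:R / 2) / Gamma (1 + m%:R / 2).

(* Lines through the origin of R^(n+1). *)
Record line (R : realType) (n : nat) := Line {
  lvs :> {vspace 'rV[R]_n.+1};
  _ : \dim lvs == 1%N
}.

HB.instance Definition _ (R : realType) (n : nat) :=
  [isSub of line R n for @lvs R n].
HB.instance Definition _ (R : realType) (n : nat) :=
  [Choice of line R n by <:].

Lemma line_subproof (R : realType) (n : nat) :
  \dim <[const_mx 1 : 'rV[R]_n.+1]>%VS == 1%N.
Proof.
rewrite dim_vline eqb1; apply/eqP => /rowP /(_ ord0) /eqP.
by rewrite !mxE oner_eq0.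
Qed.

HB.instance Definition _ (R : realType) (n : nat) :=
  isPointed.Build (line R n) (Line (line_subproof R n)).

(* The quotient topology for x |-> <[x]>, from R^(n+1) minus the origin. *)
Definition line_open (R : realType) (n : nat) : set (set (line R n)) :=
  [set A | open [set x : 'rV[R]_n.+1 | x != 0 /\
                   exists2 L : line R n, A L & x \in L]].

Definition line_space (R : realType) (n : nat) :=
  g_sigma_algebraType (@line_open R n).

Definition rotation (R : realType) (d : nat) (O : 'M[R]_d) : Prop :=
  O *m O^T = 1%:M /\ \det O = 1.

Definition rotate_lines (R : realType) (n : nat) (O : 'M[R]_n.+1)
    (A : set (line R n)) : set (line R n) :=
  [set M | exists2 L : line R n,
     A L & lvs M = (linfun (mulmxr O) @: L)%VS].

(* Together with being a probability measure, this characterizes the Haar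
   measure on the lines. *)
Definition rotation_invariant (R : realType) (n : nat)
    (mu : probability (line_space R n) R) : Prop :=
  forall (O : 'M[R]_n.+1) (A : set (line_space R n)),
    rotation O -> measurable A -> mu (rotate_lines O A) = mu A.

Definition orth_proj (R : realType) (n : nat) (L : line R n)
    (K : set 'rV[R]_n.+1) : set 'rV[R]_n.+1 :=
  [set y | y \in L /\
     exists2 x, K x & forall z, z \in L -> dotp (x - y) z = 0].

Definition unit_dir (R : realType) (n : nat) (L : line R n) : 'rV[R]_n.+1 :=
  (enorm (vpick L))^-1 *: vpick L.

(* One-dimensional Lebesgue measure on L, through the isometry
   t |-> t *: unit_dir L from the real line onto L. *)
Definition Vol1 (R : realType) (n : nat) (L : line R n)
    (S : set 'rV[R]_n.+1) : \bar R :=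
  lebesgue_measure [set t : R | S (t *: unit_dir L)].

Definition V1 (R : realType) (n : nat) (mu : probability (line_space R n) R)
    (K : set 'rV[R]_n.+1) : \bar R :=
  ((n.+1%:R * kappa R n.+1 / (kappa R 1 * kappa R n))%:E *
     \int[mu]_(L in [set: line_space R n]) Vol1 L (orth_proj L K))%E.

(* Main.v *)
(* If K contains an i-dimensional ball of radius r, then its width along a unit
   vector u is at least 2 r |P u|, where P projects onto the i-dimensional
   direction of the ball.  For u on a uniformly random line of R^d, rotation
   invariance gives E |P u|^2 = i / d and E |P u|^4 <= 3 (i / d)^2, hence
   E |P u| >= (2/9) sqrt(i / d).  As the factor d kappa_d / (kappa_1 kappa_(d-1))
   is of order sqrt d, this yields r_i(K) <= C V_1(K) / sqrt i.  Then
   r_1^2 + ... + r_d^2 <= C^2 V_1^2 (1 + 1/2 + ... + 1/d), and both the harmonic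
   sum and ln d are at most 2 sqrt d, so their product is at most 4 d. *)

Require Import Defs.
From HB Require Import structures.
From mathcomp Require Import all_boot all_order all_algebra.
From mathcomp Require Import all_classical all_reals all_analysis.
From mathcomp Require Import measurable_realfun.
From mathcomp Require Import ring lra.

Set Implicit Arguments.
Unset Strict Implicit.
Unset Printing Implicit Defensive.

Import Order.TTheory GRing.Theory Num.Theory.
Import numFieldNormedType.Exports.

Local Open Scope classical_set_scope.
Local Open Scope ring_scope.

(** * The Gamma function at half-integers, and the normalising factor of [V1] *)

Section Gamma_bounds.
Context {R : realType}.
Local Notation leb := (@lebesgue_measure R).

Definition gamma_integrand (x t : R) : R := t `^ (x - 1) * expR (- t).

(** Kept in the extended reals: the inequalities below hold before finiteness is known, and
    finiteness is then deduced from them. *)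
Definition eGamma (x : R) : \bar R :=
  (\int[leb]_(t in `[0%R, +oo[) (gamma_integrand x t)%:E)%E.

Lemma gamma_integrand_ge0 (x t : R) : 0 <= gamma_integrand x t.
Proof. by rewrite mulr_ge0 ?powR_ge0 ?expR_ge0. Qed.

Lemma measurable_expRN : measurable_fun [set: R] (fun t : R => expR (- t)).
Proof.
apply: measurableT_comp; first exact: measurable_expR.
exact: oppr_measurable.
Qed.

Lemma measurable_gamma_integrand (x : R) :
  measurable_fun [set: R] (gamma_integrand x).
Proof.
by apply: measurable_funM; [exact: measurable_powR|exact: measurable_expRN].
Qed.

Lemma GammaE (x : R) : Gamma x = fine (eGamma x).
Proof.
rewrite /Gamma /Rintegral /eGamma integral_itv_obnd_cbnd//.
apply: measurable_funTS; apply/measurable_EFinP.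
exact: measurable_gamma_integrand.
Qed.

Lemma eGamma_ge0 (x : R) : (0 <= eGamma x)%E.
Proof. by apply: integral_ge0 => t _; rewrite lee_fin gamma_integrand_ge0. Qed.

Lemma continuous_expRN : continuous (fun t : R => expR (- t)).
Proof.
move=> t; apply: continuous_comp; last exact: continuous_expR.
exact: (@continuousN _ R^o).
Qed.

Lemma powR_cvg_at_right0 (p : R) : 0 <= p ->
  (t `^ p @[t --> (0 : R)^'+] --> (0 : R) `^ p).
Proof.
rewrite le_eqVlt => /predU1P[<-|p0].
  (* Since 0^0 is 1 by convention, the limit agrees with the value at 0 for [p = 0] too. *)
  rewrite powRr0 (_ : (fun t => _) = cst 1); first exact: cvg_cst.
  by apply/funext => t; rewrite powRr0.
by rewrite powR0 ?gt_eqF//; exact: powR_cvg0.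
Qed.

Lemma continuous_powR_gt0 (p t : R) : 0 < t -> {for t, continuous (@powR R ^~ p)}.
Proof.
move=> t0; apply: differentiable_continuous; apply/derivable1_diffP.
by apply: derivable_powR; rewrite in_itv/= t0.
Qed.

(** Integration by parts on [0, n+1], then a supremum over [n]. The boundary term is nonpositive and
    is dropped, which leaves an inequality without any limit at infinity. The bound [1 <= y] makes
    t^(y-1) continuous up to 0. *)
Lemma eGammaS_le (y : R) : 1 <= y -> (eGamma (y + 1) <= y%:E * eGamma y)%E.
Proof.
move=> y1; have y0 : 0 < y by lra.
rewrite {1}/eGamma ge0_integral_ereal_sup; last 2 first.
- exact: gamma_integrand_ge0.
- exact: measurable_gamma_integrand.
apply: ge_ereal_sup => _ [n _ <-].
have n0 : (0 : R) < n.+1%:R by rewrite ltr0n.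
rewrite [X in (X <= _)%E](_ : _ =
    (\int[leb]_(x in `[0%R, (n.+1%:R : R)%R]) ((x `^ y) * expR (- x))%:E)%E); last first.
  by apply: eq_integral => t _; rewrite /gamma_integrand addrK.
have cpow c p : 0 <= p ->
    {within `[0, n.+1%:R], continuous (fun t : R => c * t `^ p)}.
  move=> p0; apply/continuous_within_itvP => //; split.
  - move=> t; rewrite in_itv/= => /andP[t0 _].
    by apply: cvgM; [exact: cvg_cst|exact: continuous_powR_gt0].
  - by apply: cvgM; [exact: cvg_cst|exact: powR_cvg_at_right0].
  - apply/cvg_at_left_filter.
    by apply: cvgM; [exact: cvg_cst|exact: continuous_powR_gt0].
rewrite (@integration_by_parts _ (@powR R ^~ y) (fun t => - expR (- t))
   (fun t => y * t `^ (y - 1)) (fun t => expR (- t)))//; last 6 first.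
- by apply: cpow; lra.
- split.
  + by move=> t; rewrite in_itv/= => /andP[t0 _]; apply: derivable_powR; rewrite in_itv/= t0.
  + by apply: powR_cvg_at_right0; lra.
  + by apply/cvg_at_left_filter; exact: continuous_powR_gt0.
- move=> t; rewrite in_itv/= => /andP[t0 _].
  by rewrite powR_derive1// in_itv/= t0.
- exact/continuous_subspaceT/continuous_expRN.
- split.
  + by move=> t _; exact: ex_derive.
  + by apply/cvg_at_right_filter; apply: cvgN; exact: continuous_expRN.
  + by apply/cvg_at_left_filter; apply: cvgN; exact: continuous_expRN.
- move=> t _; rewrite derive1E derive_val.
  by rewrite mulrN1 opprK.
rewrite [leRHS](_ : _ = (\int[leb]_(t in `[0%R, +oo[)
    (y%:E * (gamma_integrand y t)%:E))%E); last first.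
  rewrite ge0_integralZl_EFin//.
  - by move=> t _; rewrite lee_fin gamma_integrand_ge0.
  - apply: measurable_funTS; apply/measurable_EFinP.
    exact: measurable_gamma_integrand.
  - exact: ltW.
under eq_integral => t _ do rewrite mulrN EFinN.
rewrite integral_ge0N; last first.
  by move=> t _; rewrite lee_fin !mulr_ge0 ?powR_ge0 ?expR_ge0 ?ltW.
rewrite oppeK powR0 ?gt_eqF// mul0r subr0 mulrN.
rewrite -[leRHS]add0e; apply: leeD.
  by rewrite lee_fin oppr_le0 mulr_ge0 ?powR_ge0 ?expR_ge0.
under eq_integral => t _ do rewrite -mulrA EFinM.
apply: ge0_subset_integral => //=.
- apply: measurable_funTS; apply/measurable_EFinP.
  apply: measurable_funM; first exact: measurable_cst.
  exact: measurable_gamma_integrand.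
- by move=> t _; rewrite lee_fin mulr_ge0 ?gamma_integrand_ge0 ?ltW.
- exact: subset_itvl.
Qed.

(** This is the total mass of the exponential law of rate 1. *)
Lemma eGamma1 : eGamma 1 = 1%E.
Proof.
rewrite -(integral_exponential_pdf (@ltr01 R)) /eGamma integral_mkcond.
apply: eq_integral => t _; rewrite /exponential_pdf !patchE.
case: ifP => // _.
by rewrite /gamma_integrand subrr powRr0 !mul1r mulN1r.
Qed.

(** Weighted AM-GM: t^(y-1/2) is the product of the square roots [a] of t^(y-1) and [b] of t^y, and
    the difference of the two sides is (l a - b)^2 / l. *)
Lemma powR_half_AMGM (l t y : R) : 1 <= y -> 0 < l -> 0 <= t ->
  2 * t `^ (y + 2^-1 - 1) <= l * t `^ (y - 1) + l^-1 * t `^ (y + 1 - 1).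
Proof.
move=> y1 l0; rewrite le_eqVlt => /predU1P[<-|t0].
  rewrite powR0 ?mulr0; last by rewrite gt_eqF//; lra.
  by rewrite addr_ge0// mulr_ge0 ?powR_ge0 ?invr_ge0 ?ltW.
set a := t `^ ((y - 1) / 2); set b := t `^ (y / 2).
have tn0 : t != 0 by rewrite gt_eqF.
have -> : t `^ (y + 2^-1 - 1) = a * b.
  by rewrite -powRD ?tn0 ?implybT//; congr (_ `^ _); field.
have -> : t `^ (y - 1) = a ^+ 2.
  by rewrite expr2 -powRD ?tn0 ?implybT//; congr (_ `^ _); field.
have -> : t `^ (y + 1 - 1) = b ^+ 2.
  by rewrite expr2 -powRD ?tn0 ?implybT//; congr (_ `^ _); field.
have : 0 <= l^-1 * (l * a - b) ^+ 2 by rewrite mulr_ge0 ?invr_ge0 ?sqr_ge0 ?ltW.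
move=> h; rewrite -subr_ge0; move: h; congr (is_true (0 <= _)).
by field; exact: lt0r_neq0.
Qed.

(** The weight [l] stays free: [l = 1] serves to prove finiteness, and the square root of [y] gives
    the best bound. *)
Lemma eGamma_half_le (l y : R) : 1 <= y -> 0 < l ->
  (2%:E * eGamma (y + 2^-1) <=
     l%:E * eGamma y + l^-1%:E * (y%:E * eGamma y))%E.
Proof.
move=> y1 l0.
have mg x : measurable_fun (`[0, +oo[%classic : set R) (EFin \o gamma_integrand x).
  apply: measurable_funTS; apply/measurable_EFinP.
  exact: measurable_gamma_integrand.
have g0 x t : (`[0, +oo[%classic : set R) t -> (0 <= (gamma_integrand x t)%:E)%E.
  by move=> _; rewrite lee_fin gamma_integrand_ge0.
apply: (@le_trans _ _ (l%:E * eGamma y + l^-1%:E * eGamma (y + 1))%E); last first.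
  apply: leeD => //; apply: lee_wpmul2l; first by rewrite lee_fin invr_ge0 ltW.
  exact: eGammaS_le.
have Z c x : 0 <= c -> (c%:E * eGamma x =
    \int[leb]_(t in `[0%R, +oo[) (c * gamma_integrand x t)%:E)%E.
  move=> c0; rewrite /eGamma -ge0_integralZl_EFin//; first exact: g0.
  exact: mg.
have mcg c x : measurable_fun (`[0, +oo[%classic : set R) (fun t => (c * gamma_integrand x t)%:E).
  apply/measurable_EFinP; apply: measurable_funM; first exact: measurable_cst.
  by apply/measurable_EFinP; exact: mg.
have cg0 c x t : 0 <= c -> (0 <= (c * gamma_integrand x t)%:E)%E.
  by move=> c0; rewrite lee_fin mulr_ge0 ?gamma_integrand_ge0.
have li0 : 0 <= l^-1 by rewrite invr_ge0 ltW.
rewrite (Z 2)// (Z l) ?(ltW l0)// (Z l^-1)// -ge0_integralD//; last 4 first.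
- by move=> t _; apply: cg0; exact: ltW.
- exact: mcg.
- by move=> t _; exact: cg0.
- exact: mcg.
apply: ge0_le_integral => //.
- by move=> t _; exact: cg0.
- exact: mcg.
- by apply: emeasurable_funD; exact: mcg.
- move=> t; rewrite /= in_itv/= andbT => t0; rewrite -EFinD lee_fin.
  rewrite /gamma_integrand !mulrA -mulrDl ler_wpM2r ?expR_ge0//.
  exact: powR_half_AMGM.
Qed.

(** [Gamma] is [fine] of this integral and would be 0 if the integral were infinite. *)
Lemma eGamma_half_fin (m : nat) : eGamma (1 + m%:R / 2) \is a fin_num.
Proof.
(* Two consecutive half-integers are carried along because the recurrence shifts the argument by
   1. *)
suff : eGamma (1 + m%:R / 2) \is a fin_num /\
    eGamma (1 + m.+1%:R / 2) \is a fin_num by case.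
elim: m => [|m [ih1 ih2]].
    rewrite mul0r addr0 eGamma1; split => //.
    have := @eGamma_half_le 1 1 (lexx _) ltr01.
    rewrite eGamma1 invr1 !mul1e mul1r => h.
    rewrite ge0_fin_numE ?eGamma_ge0//.
    rewrite -(@lte_pmul2l _ 2%:E)// [ltRHS]gt0_muley// (le_lt_trans h)//.
    by rewrite -EFinD ltry.
  split; first exact: ih2.
  rewrite ge0_fin_numE ?eGamma_ge0//.
  have -> : 1 + m.+2%:R / 2 = (1 + m%:R / 2) + 1 :> R by rewrite -!natr1; field.
  apply: le_lt_trans; first by apply: eGammaS_le; rewrite lerDl divr_ge0.
  by rewrite -(fineK ih1) -EFinM ltry.
Qed.

Lemma Gamma_half_le (m : nat) :
  Gamma (1 + m.+1%:R / 2) <=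
    Num.sqrt (1 + m%:R / 2) * Gamma (1 + m%:R / 2) :> R.
Proof.
set y : R := 1 + m%:R / 2.
have y1 : 1 <= y by rewrite lerDl divr_ge0.
have y0 : 0 < y by exact: lt_le_trans y1.
have l0 : 0 < Num.sqrt y by rewrite sqrtr_gt0.
have -> : 1 + m.+1%:R / 2 = y + 2^-1 :> R by rewrite /y -natr1; field.
(* With l the square root of [y], both [l] and y / l equal that root, and the factor 2 cancels. *)
have := eGamma_half_le y1 l0.
have := eGamma_half_fin m.+1; have := eGamma_half_fin m.
have -> : 1 + m.+1%:R / 2 = y + 2^-1 :> R by rewrite /y -natr1; field.
rewrite -/y !GammaE; case: (eGamma y) (eGamma (y + 2^-1)) => [a||] [b||]//= _ _.
rewrite -!EFinM -EFinD lee_fin mulrA.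
have -> : (Num.sqrt y)^-1 * y = Num.sqrt y.
  by rewrite -{2}(sqr_sqrtr (ltW y0)) expr2 mulKf// gt_eqF.
lra.
Qed.

Lemma Gamma_half_gt0 (m : nat) : 0 < Gamma (1 + m%:R / 2) :> R.
Proof.
set y : R := 1 + m%:R / 2.
have y1 : 1 <= y by rewrite lerDl divr_ge0.
rewrite GammaE; have := eGamma_half_fin m; rewrite -/y => fG.
rewrite fine_gt0//; apply/andP; split; last by rewrite -ge0_fin_numE ?eGamma_ge0.
(* On [1, 2], an interval of length 1, t^(y-1) is at least 1 and exp(-t) at least exp(-2). *)
apply: (@lt_le_trans _ _ (expR (-2))%:E); first by rewrite lte_fin expR_gt0.
have <- : (\int[leb]_(t in `[1%R, 2%R]) cst (expR (-2))%:E t)%E = (expR (-2))%:E.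
  rewrite integral_cst//= lebesgue_measure_itv/= lte_fin ltr1n.
  by rewrite -EFinB (_ : 2 - 1 = 1 :> R) ?mule1//; ring.
apply: (@le_trans _ _ (\int[leb]_(t in `[1%R, 2%R]) (gamma_integrand y t)%:E)%E).
  apply: ge0_le_integral => //.
  - by move=> t _; rewrite lee_fin expR_ge0.
  - apply: measurable_funTS; apply/measurable_EFinP.
    exact: measurable_gamma_integrand.
  - move=> t; rewrite /= in_itv/= => /andP[t1 t2]; rewrite lee_fin.
    rewrite -[leLHS]mul1r ler_pM ?expR_ge0//; last by rewrite ler_expR lerN2.
    by rewrite -[leLHS](powRr0 t) ler_powR// subr_ge0.
apply: ge0_subset_integral => //.
- apply: measurable_funTS; apply/measurable_EFinP.
  exact: measurable_gamma_integrand.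
- by move=> t _; rewrite lee_fin gamma_integrand_ge0.
- by move=> t; rewrite /= !in_itv/= andbT => /andP[t1 _]; lra.
Qed.

(** The powers of pi cancel. What remains is Gamma(3/2) times (n+1) Gamma(1+n/2) / Gamma(1+(n+1)/2);
    by [Gamma_half_le] the latter is at least (n+1) / sqrt(1+n/2), and 1 + n/2 <= n + 1. *)
Lemma V1_factor_ge (n : nat) :
  Gamma (1 + 1%:R / 2) * Num.sqrt n.+1%:R <=
    n.+1%:R * kappa R n.+1 / (kappa R 1 * kappa R n).
Proof.
have G n' := Gamma_half_gt0 n'; have pi0 := pi_gt0 R.
have Pm m : pi `^ (m.+1%:R / 2) = pi `^ (m%:R / 2) * Num.sqrt pi :> R.
  rewrite -powR12_sqrt ?ltW// -powRD ?gt_eqF ?implybT//; congr (_ `^ _).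
  by rewrite -natr1; field.
have s0 : 0 < Num.sqrt (pi : R) by rewrite sqrtr_gt0.
rewrite /kappa Pm (Pm 0%N) mul0r powRr0 mul1r.
have [p0 gn gS g1] : [/\ pi `^ (n%:R / 2) != 0 :> R, Gamma (1 + n%:R / 2) != 0 :> R,
    Gamma (1 + n.+1%:R / 2) != 0 :> R & Gamma (1 + 1%:R / 2) != 0 :> R].
  by split; rewrite gt_eqF ?powR_gt0.
have sn0 : Num.sqrt (pi : R) != 0 by rewrite gt_eqF.
rewrite [leRHS](_ : _ = Gamma (1 + 1%:R / 2) *
    (n.+1%:R * Gamma (1 + n%:R / 2) / Gamma (1 + n.+1%:R / 2))); last first.
  move: (n.+1%:R) (Gamma (1 + n%:R / 2)) (Gamma (1 + n.+1%:R / 2)) gn gS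
    (Gamma (1 + 1%:R / 2)) g1 (pi `^ (n%:R / 2)) p0 (Num.sqrt pi) sn0.
  by move=> N a b a0 b0 e e0 p p0 q q0; field; rewrite a0 b0 e0 p0 q0.
rewrite ler_pM2l; last exact: G.
rewrite ler_pdivlMr; last exact: G.
have /(ler_wpM2l (sqrtr_ge0 n.+1%:R)) := Gamma_half_le n.
move=> /le_trans; apply; rewrite mulrA ler_pM2r// -sqrtrM//.
rewrite -[leRHS](@ger0_norm R)// -sqrtr_sqr ler_wsqrtr// expr2.
apply: ler_wpM2l; first exact: ler0n.
by rewrite -(natr1 n); have := ler0n R n; lra.
Qed.

End Gamma_bounds.

(** * Euclidean geometry: reflections, orthonormal families, rotations *)

Section Euclidean.
Context {R : realType} {d : nat}.
Implicit Types (x y z e f : 'rV[R]_d) (a : R).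

Lemma dotpE x y : dotp x y = (x *m y^T) 0 0.
Proof. by rewrite mxE; apply: eq_bigr => i _; rewrite mxE. Qed.

Lemma dotpC x y : dotp x y = dotp y x.
Proof. by apply: eq_bigr => i _; rewrite mulrC. Qed.

Lemma dotpDl x y z : dotp (x + y) z = dotp x z + dotp y z.
Proof. by rewrite !dotpE mulmxDl mxE. Qed.

Lemma dotpZl a x y : dotp (a *: x) y = a * dotp x y.
Proof. by rewrite !dotpE -scalemxAl mxE. Qed.

Lemma dotpDr x y z : dotp x (y + z) = dotp x y + dotp x z.
Proof. by rewrite !(dotpC x) dotpDl. Qed.

Lemma dotpZr a x y : dotp x (a *: y) = a * dotp x y.
Proof. by rewrite !(dotpC x) dotpZl. Qed.

Lemma dotpNl x y : dotp (- x) y = - dotp x y.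
Proof. by rewrite -scaleN1r dotpZl mulN1r. Qed.

Lemma dotpNr x y : dotp x (- y) = - dotp x y.
Proof. by rewrite !(dotpC x) dotpNl. Qed.

Lemma dotp0l x : dotp 0 x = 0.
Proof. by rewrite dotpE mul0mx mxE. Qed.

Lemma dotp_suml (I : Type) (r : seq I) (P : pred I) (F : I -> 'rV[R]_d) x :
  dotp (\sum_(i <- r | P i) F i) x = \sum_(i <- r | P i) dotp (F i) x.
Proof.
apply: (big_morph (fun y => dotp y x)); last exact: dotp0l.
by move=> y z; exact: dotpDl.
Qed.

Lemma dotp_sumr (I : Type) (r : seq I) (P : pred I) (F : I -> 'rV[R]_d) x :
  dotp x (\sum_(i <- r | P i) F i) = \sum_(i <- r | P i) dotp x (F i).
Proof. by rewrite dotpC dotp_suml; apply: eq_bigr => i _; rewrite dotpC. Qed.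

Lemma dotp_delta x (i : 'I_d) : dotp x (delta_mx 0 i) = x 0 i.
Proof.
rewrite /dotp (bigD1 i)//= big1 ?addr0 => [|j /negPf ji].
  by rewrite mxE !eqxx mulr1.
by rewrite mxE ji andbF mulr0.
Qed.

Lemma dotp_ge0 x : 0 <= dotp x x.
Proof. by apply: sumr_ge0 => i _; rewrite -expr2 sqr_ge0. Qed.

Lemma dotp_eq0 x : (dotp x x == 0) = (x == 0).
Proof.
apply/eqP/eqP => [/eqP|->]; last exact: dotp0l.
rewrite psumr_eq0 => [/allP x0|i _]; last by rewrite -expr2 sqr_ge0.
apply/rowP => i; have := x0 i; rewrite mem_index_enum => /(_ isT).
by rewrite mulf_eq0 orbb => /eqP ->; rewrite mxE.
Qed.

Lemma dotp_gt0 x : (0 < dotp x x) = (x != 0).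
Proof. by rewrite lt_neqAle dotp_ge0 andbT eq_sym dotp_eq0. Qed.

Lemma sqr_enorm x : enorm x ^+ 2 = dotp x x.
Proof. by rewrite sqr_sqrtr// dotp_ge0. Qed.

Lemma dotp_normalize x (u := (enorm x)^-1 *: x) : x != 0 -> dotp u u = 1.
Proof.
move=> x0; rewrite /u dotpZl dotpZr mulrA -expr2 exprVn sqr_enorm mulVf//.
by rewrite dotp_eq0.
Qed.

Lemma dotp_mulmx_orth (O : 'M[R]_d) x y : O *m O^T = 1%:M ->
  dotp (x *m O) (y *m O) = dotp x y.
Proof. by move=> OO; rewrite !dotpE trmx_mul mulmxA -(mulmxA x) OO mulmx1. Qed.

(** Expand the squared norm of x - <x, y> y, which is nonnegative. *)
Lemma dotp_CS x y : dotp y y = 1 -> dotp x y ^+ 2 <= dotp x x.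
Proof.
move=> y1; have := dotp_ge0 (x - dotp x y *: y).
rewrite dotpDl !dotpDr !dotpNl !dotpNr !dotpZl !dotpZr y1 (dotpC y x).
nra.
Qed.

Lemma mul_tr_dotp x y : x *m y^T = (dotp x y)%:M.
Proof. by rewrite [LHS]mx11_scalar dotpE. Qed.

(** [H] is the Householder reflection in the hyperplane orthogonal to [x]; it is symmetric and
    squares to the identity. *)
Lemma reflection_orth x (H := 1%:M - (2 / dotp x x) *: (x^T *m x)) :
  x != 0 -> H *m H^T = 1%:M.
Proof.
rewrite -dotp_eq0 => x0; pose P := x^T *m x.
have PT : P^T = P by rewrite trmx_mul trmxK.
have PP : P *m P = dotp x x *: P.
  by rewrite /P mulmxA -(mulmxA x^T x) mul_tr_dotp mul_mx_scalar scalemxAl.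
have -> : H^T = H by rewrite /H -/P linearB/= linearZ/= trmx1 PT.
rewrite /H -/P mulmxBl mul1mx mulmxBr mulmx1 -scalemxAl -scalemxAr PP !scalerA.
have -> : 2 / dotp x x * (2 / dotp x x) * dotp x x = 2 / dotp x x + 2 / dotp x x.
  by field.
by rewrite scalerDl opprB addrK subrK.
Qed.

(** For distinct unit vectors, the reflection in the hyperplane orthogonal to [e - f] exchanges
    them. *)
Lemma exists_orthogonal_map e f : dotp e e = 1 -> dotp f f = 1 ->
  exists2 H : 'M[R]_d, H *m H^T = 1%:M & e *m H = f.
Proof.
move=> e1 f1; have [<-|ef] := eqVneq e f.
  by exists 1%:M; rewrite ?trmx1 mulmx1.
pose v := e - f.
have v0 : v != 0 by rewrite subr_eq0.
exists (1%:M - (2 / dotp v v) *: (v^T *m v)); first exact: reflection_orth.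
rewrite mulmxBr mulmx1 -scalemxAr mulmxA mul_tr_dotp mul_scalar_mx scalerA.
have -> : 2 / dotp v v * dotp e v = 1.
  have -> : dotp e v = dotp v v / 2.
    by rewrite /v !(dotpDl, dotpDr, dotpNl, dotpNr) e1 f1 (dotpC f e); field.
  by field; rewrite dotp_eq0.
by rewrite scale1r /v opprB addrC subrK.
Qed.

(** Induction on [k]: pick a unit vector [v] in [V] and continue in the part of [V] orthogonal to
    [v], the kernel of one linear form, whose dimension drops by at most one. *)
Lemma exists_orthonormal (V : {vspace 'rV[R]_d}) (k : nat) : (k <= \dim V)%N ->
  exists e : 'I_k -> 'rV[R]_d,
    (forall j, e j \in V) /\ (forall i j, dotp (e i) (e j) = (i == j)%:R).
Proof.
elim: k V => [|k ih] V kV; first by exists (fun=> 0); split => -[].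
have V0 : vpick V != 0.
  by rewrite vpick0; apply: contraTneq kV => ->; rewrite dimv0.
pose v := (enorm (vpick V))^-1 *: vpick V.
have vV : v \in V by rewrite memvZ// memv_pick.
have v1 : dotp v v = 1 by exact: dotp_normalize.
pose f := linfun (mulmxr v^T : 'rV[R]_d -> 'M[R]_1).
have [] := ih (V :&: lker f)%VS.
  have fV1 : (\dim (f @: V) <= 1)%N.
    by rewrite (leq_trans (dimvS (subvf _)))// dimvf dim_matrix.
  rewrite -ltnS (leq_trans kV)// -(limg_ker_dim f V).
  by rewrite -(addn1 (\dim (V :&: _))) leq_add2l.
move=> e [eV ee].
exists (fun j => if unlift ord0 j is Some i then e i else v); split=> [j|i j].
  by case: unliftP => [i _|_]//; have := eV i; rewrite memv_cap => /andP[].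
have ev i' : dotp (e i') v = 0.
  have := eV i'; rewrite memv_cap memv_ker lfunE/= => /andP[_ /eqP ev].
  by rewrite dotpE ev mxE.
case: (unliftP ord0 i) => [i' ->|->]; case: (unliftP ord0 j) => [j' ->|->].
- by rewrite ee (inj_eq (@lift_inj _ _)).
- by rewrite ev eq_sym (negPf (neq_lift _ _)).
- by rewrite dotpC ev (negPf (neq_lift _ _)).
- by rewrite v1 eqxx.
Qed.

End Euclidean.

(** An orthogonal map of determinant -1 is corrected by flipping the first coordinate, at the price
    of a sign. In dimension one the sign is unavoidable; it is harmless for functions of lines. *)
Lemma exists_rotation (R : realType) (n : nat) (e : 'rV[R]_n.+1) :
  dotp e e = 1 -> exists2 O : 'M[R]_n.+1, rotation O &
    e *m O = delta_mx 0 0 \/ e *m O = - delta_mx 0 0.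
Proof.
move=> e1; have d1 : dotp (delta_mx 0 0 : 'rV[R]_n.+1) (delta_mx 0 0) = 1.
  by rewrite dotp_delta mxE !eqxx.
have [H HH eH] := exists_orthogonal_map e1 d1.
have : \det H ^+ 2 = 1 by rewrite expr2 -{2}det_tr -det_mulmx HH det1.
move=> /eqP; rewrite sqrf_eq1 => /orP[] /eqP dH.
  by exists H => //; left.
pose r : 'rV[R]_n.+1 := \row_i (if i == 0 then -1 else 1).
exists (H *m diag_mx r); last first.
  right; rewrite mulmxA eH; apply/rowP => i; rewrite mul_mx_diag !mxE eqxx/=.
  by case: (i == 0); rewrite ?mulrN1 ?mul0r ?oppr0.
split.
  rewrite trmx_mul tr_diag_mx mulmxA -(mulmxA H) mulmx_diag.
  have -> : (\row_j (r 0 j * r 0 j))%R = const_mx 1.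
    by apply/rowP => i; rewrite !mxE; case: ifP; rewrite ?mulrNN mulr1.
  by rewrite diag_const_mx mulmx1.
rewrite det_mulmx dH det_diag big_ord_recl big1 => [|i _]; last by rewrite mxE.
by rewrite mxE eqxx mulr1 mulrNN mulr1.
Qed.

(** * The space of lines and the squared cosine with a fixed vector *)

Section Lines.
Context {R : realType} {n : nat}.
Implicit Types (L : line R n) (e x y : 'rV[R]_n.+1).

(** For a unit vector [e], the squared cosine of the angle between [L] and [e]. The square removes
    the dependence on the arbitrary sign of [unit_dir L]. *)
Definition cos2 e (L : line_space R n) : R := dotp (unit_dir L) e ^+ 2.

Lemma dim_line L : \dim L = 1%N.
Proof. by case: L => V /= /eqP. Qed.

Lemma vpick_line_neq0 L : vpick L != 0.
Proof. by rewrite vpick0 -dimv_eq0 dim_line. Qed.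

Lemma unit_dir_in L : unit_dir L \in lvs L.
Proof. by rewrite memvZ// memv_pick. Qed.

Lemma dotp_unit_dir L : dotp (unit_dir L) (unit_dir L) = 1.
Proof. exact: dotp_normalize (vpick_line_neq0 L). Qed.

Lemma unit_dir_neq0 L : unit_dir L != 0.
Proof. by rewrite -dotp_eq0 dotp_unit_dir oner_eq0. Qed.

Lemma line_span L x : x != 0 -> x \in lvs L -> lvs L = <[x]>%VS.
Proof.
move=> x0 xL; apply/esym/eqP.
by rewrite eqEdim -memvE xL dim_line dim_vline x0.
Qed.

Lemma line_mem L x : x \in lvs L -> exists a, x = a *: unit_dir L.
Proof.
by rewrite (line_span (unit_dir_neq0 L) (unit_dir_in L)) => /vlineP.
Qed.

(** The homogeneous form lets [cos2] be read off any vector of the line, not just the chosen unit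
    one. *)
Lemma cos2_mem L x e : x \in lvs L -> cos2 e L * dotp x x = dotp x e ^+ 2.
Proof.
move=> /line_mem[a ->]; rewrite /cos2; have := dotp_unit_dir L.
by move: (unit_dir L) => u u1; rewrite !(dotpZl, dotpZr) u1; ring.
Qed.

Lemma cos2_ge0 e L : 0 <= cos2 e L.
Proof. exact: sqr_ge0. Qed.

Lemma cos2_le1 e L : dotp e e = 1 -> cos2 e L <= 1.
Proof. by move=> e1; rewrite -(dotp_unit_dir L); exact: dotp_CS. Qed.

Lemma cos2N e L : cos2 (- e) L = cos2 e L.
Proof. by rewrite /cos2 dotpNr sqrrN. Qed.

Lemma sum_cos2_delta L : \sum_(i < n.+1) cos2 (delta_mx 0 i) L = 1.
Proof.
rewrite -(dotp_unit_dir L); apply: eq_bigr => i _.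
by rewrite /cos2 dotp_delta expr2.
Qed.

Lemma continuous_sum (T : topologicalType) (m : nat) (F : 'I_m -> T -> R) :
  (forall i, continuous (F i)) -> continuous (fun t => \sum_(i < m) F i t).
Proof.
move=> cF; apply: continuous_big => //.
exact: add_continuous.
Qed.

Lemma continuous_dotp x : continuous (fun y : 'rV[R]_n.+1 => dotp y x).
Proof.
apply: continuous_sum => i y.
by apply: continuousM; [exact: coord_continuous|exact: cst_continuous].
Qed.

Lemma continuous_sqnorm : continuous (fun y : 'rV[R]_n.+1 => dotp y y).
Proof.
by apply: continuous_sum => i y; apply: continuousM; exact: coord_continuous.
Qed.

Lemma line_exists x : x != 0 -> exists L : line R n, x \in lvs L.
Proof.
move=> x0; have dx : \dim <[x]>%VS == 1%N by rewrite dim_vline x0.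
by exists (Line dx); rewrite /= memv_line.
Qed.

(** The preimage of an open ray below [a] is already open: its nonzero vectors are those with <x,
    e>^2 < a |x|^2, a strict inequality that excludes 0 by itself. *)
Lemma measurable_cos2 e : measurable_fun setT (cos2 e).
Proof.
apply: (measurability _ (RGenInftyO.measurableE R)).
move=> _ [_ [a ->] <-]; rewrite setTI; apply: sub_sigma_algebra.
rewrite /line_open /= [X in open X](_ : _ =
    [set x : 'rV[R]_n.+1 | dotp x e * dotp x e - a * dotp x x < 0]); last first.
  apply/seteqP; split => x /=.
    move=> [x0 [L]]; rewrite in_itv/= => cL xL.
    by rewrite subr_lt0 -expr2 -(cos2_mem _ xL) ltr_pM2r// dotp_gt0.
  rewrite subr_lt0 -expr2 => xa.
  have x0 : x != 0.
    by apply: contraTneq xa => ->; rewrite !dotp0l expr0n mulr0 ltxx.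
  split => //; have [L xL] := line_exists x0; exists L => //.
  by rewrite in_itv/= -(@ltr_pM2r _ (dotp x x)) ?dotp_gt0// cos2_mem.
have cF : continuous (fun x : 'rV[R]_n.+1 => dotp x e * dotp x e - a * dotp x x).
  move=> x; have cx := @continuous_dotp e x.
  exact: (cvgB (cvgM cx cx) (cvgM (cvg_cst a) (@continuous_sqnorm x))).
exact: (@open_comp _ _ _ [set y : R | y < 0] (fun x _ => cF x) (@open_lt R 0)).
Qed.

(** Puts events about [cos2] in the form to which rotation invariance of the measure applies. *)
Lemma rotate_lines_cos2 (O : 'M[R]_n.+1) e (B : set R) : rotation O ->
  rotate_lines O (cos2 e @^-1` B) = cos2 (e *m O) @^-1` B.
Proof.
move=> [OO _]; have OTO : O^T *m O = 1%:M by exact: mulmx1C.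
have rot (L M : line R n) : lvs M = (linfun (mulmxr O) @: L)%VS ->
    cos2 (e *m O) M = cos2 e L.
  move=> ML; have uM : unit_dir L *m O \in lvs M.
    rewrite ML; apply/memv_imgP; exists (unit_dir L); first exact: unit_dir_in.
    by rewrite lfunE.
  have := cos2_mem (e *m O) uM.
  by rewrite !dotp_mulmx_orth// dotp_unit_dir mulr1.
apply/seteqP; split => M /=.
  by move=> [L BL ML]; rewrite /preimage/= (rot L).
(* The inverse rotation carries [M] back to the line through [x]. *)
move=> BM; pose x := unit_dir M *m O^T.
have x0 : x != 0.
  apply: contra_neq (unit_dir_neq0 M) => x0.
  by rewrite -(mulmx1 (unit_dir M)) -OTO mulmxA -/x x0 mul0mx.
have [L xL] := line_exists x0.
have ML : lvs M = (linfun (mulmxr O) @: L)%VS.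
  rewrite (line_span x0 xL) limg_line lfunE/= -mulmxA OTO mulmx1.
  exact: line_span (unit_dir_neq0 M) (unit_dir_in M).
by exists L => //; rewrite /preimage/= -(rot _ _ ML).
Qed.

End Lines.

(** * Moments of a uniformly random direction *)

Section Moments.
Context {R : realType} {n : nat} (mu : probability (line_space R n) R).
Hypothesis mu_rot : rotation_invariant mu.
Implicit Types (e : 'rV[R]_n.+1) (f g : line_space R n -> R).
Local Notation d := (n.+1%:R : R).

Definition mean f : R := \int[mu]_(L in setT) f L.

(** A class of integrable functions closed under products, unlike integrability alone. *)
Definition bounded_meas f := measurable_fun setT f /\ exists M, forall L, `|f L| <= M.

Lemma bounded_meas_integrable f : bounded_meas f -> mu.-integrable setT (EFin \o f).
Proof.
move=> [mf [M fM]]; apply: measurable_bounded_integrable => //.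
  by rewrite [ltLHS](_ : _ = 1%E) ?ltry//; exact: probability_setT.
exists M; split; first exact: num_real.
by move=> y My L _; apply: le_trans (fM L) _; exact: ltW.
Qed.

Lemma bounded_measD f g : bounded_meas f -> bounded_meas g -> bounded_meas (fun L => f L + g L).
Proof.
move=> [mf [M fM]] [mg [N gN]]; split; first exact: measurable_funD.
by exists (M + N) => L; rewrite (le_trans (ler_normD _ _)) ?lerD.
Qed.

Lemma bounded_measM f g : bounded_meas f -> bounded_meas g -> bounded_meas (fun L => f L * g L).
Proof.
move=> [mf [M fM]] [mg [N gN]]; split; first exact: measurable_funM.
by exists (M * N) => L; rewrite normrM ler_pM.
Qed.

Lemma bounded_meas_cst a : bounded_meas (fun=> a).
Proof. by split; [exact: measurable_cst|exists `|a|]. Qed.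

Lemma bounded_meas_cos2 e : dotp e e = 1 -> bounded_meas (cos2 e).
Proof.
move=> e1; split; first exact: measurable_cos2.
by exists 1 => L; rewrite ger0_norm ?cos2_ge0 ?cos2_le1.
Qed.

Lemma bounded_meas_sum (I : Type) (r : seq I) (F : I -> line_space R n -> R) :
  (forall i, bounded_meas (F i)) -> bounded_meas (fun L => \sum_(i <- r) F i L).
Proof.
move=> bF; elim: r => [|i r ih].
  rewrite (_ : (fun L => _) = fun=> 0); first exact: bounded_meas_cst.
  by apply/funext => L; rewrite big_nil.
rewrite (_ : (fun L => _) = fun L => F i L + \sum_(j <- r) F j L).
  exact: bounded_measD.
by apply/funext => L; rewrite big_cons.
Qed.

Lemma meanD f g : bounded_meas f -> bounded_meas g ->
  mean (fun L => f L + g L) = mean f + mean g.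
Proof. by move=> bf bg; rewrite /mean RintegralD//; exact: bounded_meas_integrable. Qed.

Lemma meanZ a f : bounded_meas f -> mean (fun L => a * f L) = a * mean f.
Proof. by move=> bf; rewrite /mean RintegralZl//; exact: bounded_meas_integrable. Qed.

Lemma mean_cst a : mean (fun=> a) = a.
Proof.
rewrite /mean Rintegral_cst//.
by rewrite [X in _ * fine X](_ : _ = 1%E) ?mulr1//; exact: probability_setT.
Qed.

Lemma mean_sum (I : Type) (r : seq I) (F : I -> line_space R n -> R) :
  (forall i, bounded_meas (F i)) ->
  mean (fun L => \sum_(i <- r) F i L) = \sum_(i <- r) mean (F i).
Proof.
move=> bF; elim: r => [|i r ih].
  by rewrite big_nil -[RHS](mean_cst 0); congr mean; apply/funext => L; rewrite big_nil.
rewrite big_cons -ih -meanD//; last exact: bounded_meas_sum.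
by congr mean; apply/funext => L; rewrite big_cons.
Qed.

Lemma le_mean f g : bounded_meas f -> bounded_meas g -> (forall L, f L <= g L) ->
  mean f <= mean g.
Proof.
by move=> bf bg fg; apply: le_Rintegral => //; exact: bounded_meas_integrable.
Qed.

(** By rotation invariance [cos2 e] has the same law whatever the unit vector [e]; both means are
    integrals of t^k on the half-line t >= 0 against that law. *)
Lemma mean_cos2X (k : nat) e : dotp e e = 1 ->
  mean (fun L => cos2 e L ^+ k) = mean (fun L => cos2 (delta_mx 0 0) L ^+ k).
Proof.
move=> e1; have [Q rQ eQ] := exists_rotation e1.
have cE : cos2 (e *m Q) = cos2 (delta_mx 0 0) :> (line_space R n -> R).
  by apply/funext => L; case: eQ => ->; rewrite ?cos2N.
have mX : measurable_fun (`[0, +oo[%classic : set (measurableTypeR R))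
    (fun t : R => (t ^+ k)%:E).
  by apply/measurable_EFinP; exact: exprn_measurable.
have X0 : {in (`[0, +oo[%classic : set (measurableTypeR R)),
    forall t : R, (0 <= (t ^+ k)%:E)%E}.
  by move=> t; rewrite inE/= in_itv/= andbT => t0; rewrite lee_fin exprn_ge0.
have mD : measurable (`[0, +oo[%classic : set (measurableTypeR R)).
  exact: measurable_itv.
have E e' := ge0_integral_pushforward (measurable_cos2 e') mu mD mX X0.
have T e' : cos2 e' @^-1` `[0, +oo[%classic = [set: line_space R n].
  by apply/seteqP; split => // L _; rewrite /= in_itv/= andbT cos2_ge0.
have := E e; have := E (delta_mx 0 0); rewrite !T /mean /Rintegral /= => <- <-.
congr fine; apply: eq_measure_integral; [exact: measurable_cos2..|].
move=> m0 m1 B mB _.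
change (mu (cos2 e @^-1` B) = mu (cos2 (delta_mx 0 0) @^-1` B)).
rewrite -cE -rotate_lines_cos2// mu_rot//.
by rewrite -[X in measurable X]setTI; exact: measurable_cos2.
Qed.

Lemma dotp_delta_mx (i j : 'I_n.+1) :
  dotp (delta_mx 0 i : 'rV[R]_n.+1) (delta_mx 0 j) = (i == j)%:R.
Proof. by rewrite dotp_delta mxE eqxx eq_sym. Qed.

(** The squared coordinates of a unit vector sum to 1 and have equal means. *)
Lemma mean_cos2 e : dotp e e = 1 -> d * mean (cos2 e) = 1.
Proof.
move=> e1; have D1 i : dotp (delta_mx 0 i : 'rV[R]_n.+1) (delta_mx 0 i) = 1.
  by rewrite dotp_delta_mx eqxx.
rewrite -[RHS](mean_cst 1).
under [in RHS]eq_fun => L do rewrite -(sum_cos2_delta L).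
rewrite mean_sum => [|i]; last exact: bounded_meas_cos2.
rewrite (eq_bigr (fun=> mean (cos2 e))) => [|i _].
  by rewrite sumr_const card_ord mulr_natl.
by have := mean_cos2X 1 e1; rewrite -(mean_cos2X 1 (D1 i)).
Qed.

(* Both [(u_i + u_j) / sqrt 2] and [(u_i - u_j) / sqrt 2] have the fourth
   moment [m] of a coordinate [u_i], and [(a + b)^4 + (a - b)^4] expands to
   [2 a^4 + 12 a^2 b^2 + 2 b^4]: hence [E u_i^2 u_j^2 = m / 3]. *)
Lemma mean_cos2_mul (i j : 'I_n.+1) e : dotp e e = 1 ->
  mean (fun L => cos2 e L ^+ 2) <=
    3 * mean (fun L => cos2 (delta_mx 0 i) L * cos2 (delta_mx 0 j) L).
Proof.
move=> e1; set m := mean _.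
have M (v : 'rV[R]_n.+1) : dotp v v = 1 -> mean (fun L => cos2 v L * cos2 v L) = m.
  by move=> v1; have := mean_cos2X 2 v1; rewrite -(mean_cos2X 2 e1).
pose ei : 'rV[R]_n.+1 := delta_mx 0 i; pose ej : 'rV[R]_n.+1 := delta_mx 0 j.
have ii : dotp ei ei = 1 by rewrite dotp_delta_mx eqxx.
have jj : dotp ej ej = 1 by rewrite dotp_delta_mx eqxx.
have m0 : 0 <= m by apply: Rintegral_ge0 => L _; exact: sqr_ge0.
have [->|ij] := eqVneq i j; first by rewrite M//; lra.
have ij0 : dotp ei ej = 0 by rewrite dotp_delta_mx (negPf ij).
pose s : R := (Num.sqrt 2)^-1.
have s2 : s ^+ 2 = 2^-1 by rewrite exprVn sqr_sqrtr.
pose ep := s *: (ei + ej); pose em := s *: (ei - ej).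
have pp : dotp ep ep = 1.
  rewrite dotpZl dotpZr !(dotpDl, dotpDr) (dotpC ej ei) ii jj ij0.
  by rewrite mulrA -expr2 s2; field.
have mm : dotp em em = 1.
  rewrite dotpZl dotpZr !(dotpDl, dotpDr, dotpNl, dotpNr) (dotpC ej ei).
  by rewrite ii jj ij0 mulrA -expr2 s2; field.
have b (v : 'rV[R]_n.+1) : dotp v v = 1 -> bounded_meas (fun L => cos2 v L * cos2 v L).
  by move=> v1; apply: bounded_measM; exact: bounded_meas_cos2.
have bij : bounded_meas (fun L => cos2 ei L * cos2 ej L).
  by apply: bounded_measM; exact: bounded_meas_cos2.
have E L : 2 * (cos2 ep L * cos2 ep L + cos2 em L * cos2 em L) =
    (cos2 ei L * cos2 ei L + cos2 ej L * cos2 ej L) + 6 * (cos2 ei L * cos2 ej L).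
  rewrite /cos2 /ep /em; move: (unit_dir L) => u.
  rewrite !dotpZr !dotpDr dotpNr; move: (dotp u ei) (dotp u ej) => x y.
  by rewrite !exprMn s2; field.
have := congr1 mean (funext E).
rewrite meanZ; last by apply: bounded_measD; exact: b.
rewrite !meanD ?meanZ ?M//; try by [exact: b|apply: bounded_measD; exact: b].
  lra.
by apply: bounded_measM => //; exact: bounded_meas_cst.
Qed.

(** Expand the square of the sum of all squared coordinates, which is 1: each of the d^2 products
    has mean at least a third of the fourth moment. *)
Lemma mean_cos2_sqr e : dotp e e = 1 ->
  d ^+ 2 * mean (fun L => cos2 e L ^+ 2) <= 3.
Proof.
move=> e1.
have be (i : 'I_n.+1) : bounded_meas (cos2 (delta_mx 0 i : 'rV[R]_n.+1)).
  by apply: bounded_meas_cos2; rewrite dotp_delta_mx eqxx.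
have : mean (fun L => \sum_(i < n.+1) \sum_(j < n.+1)
    (cos2 (delta_mx 0 i) L * cos2 (delta_mx 0 j) L)) = 1.
  rewrite -[RHS](mean_cst 1); congr mean; apply/funext => L.
  under eq_bigr => i _ do rewrite -mulr_sumr.
  by rewrite -mulr_suml sum_cos2_delta mulr1.
rewrite mean_sum => [E|i]; last by apply: bounded_meas_sum => j; exact: bounded_measM.
suff : \sum_(i < n.+1) \sum_(j < n.+1) mean (fun L => cos2 e L ^+ 2) <= 3 * 1.
  by rewrite !sumr_const !card_ord -mulrnA -[X in X <= _]mulr_natl natrM -expr2 mulr1.
rewrite -[X in _ <= _ * X]E mulr_sumr; apply: ler_sum => i _.
rewrite mean_sum => [|j]; last exact: bounded_measM.
by rewrite mulr_sumr; apply: ler_sum => j _; exact: mean_cos2_mul.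
Qed.

(** Write both sides as double sums and compare termwise by ab <= (a^2 + b^2) / 2. *)
Lemma sqr_sum_le (k : nat) (a : 'I_k -> R) :
  (\sum_(i < k) a i) ^+ 2 <= k%:R * \sum_(i < k) a i ^+ 2.
Proof.
rewrite expr2 mulr_suml.
under eq_bigr => i _ do rewrite mulr_sumr.
have -> : k%:R * (\sum_(i < k) a i ^+ 2) =
    \sum_(i < k) \sum_(j < k) (a i ^+ 2 / 2 + a j ^+ 2 / 2).
  under [RHS]eq_bigr => i _ do
    rewrite big_split/= sumr_const card_ord -mulr_suml.
  rewrite big_split/= sumr_const card_ord sumrMnl -mulr_suml.
  by rewrite -mulrnDl -splitr mulr_natl.
apply: ler_sum => i _; apply: ler_sum => j _.
by have := sqr_ge0 (a i - a j); nra.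
Qed.

(** For orthonormal [e], the length of the projection of a unit vector of [L] onto the span of
    [e]. *)
Definition proj_norm (k : nat) (e : 'I_k -> 'rV[R]_n.+1) (L : line_space R n) : R :=
  Num.sqrt (\sum_(i < k) cos2 (e i) L).

Lemma sqr_proj_norm (k : nat) (e : 'I_k -> 'rV[R]_n.+1) L :
  proj_norm e L ^+ 2 = \sum_(i < k) cos2 (e i) L.
Proof. by rewrite sqr_sqrtr// sumr_ge0// => i _; exact: cos2_ge0. Qed.

Lemma bounded_meas_proj_norm (k : nat) (e : 'I_k -> 'rV[R]_n.+1) :
  (forall i, dotp (e i) (e i) = 1) -> bounded_meas (proj_norm e).
Proof.
move=> e1; split.
  apply: (measurableT_comp (f := @Num.sqrt R)).
    by apply: continuous_measurable_fun; exact: sqrt_continuous.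
  by have [] := bounded_meas_sum (index_enum 'I_k) (fun i => bounded_meas_cos2 (e1 i)).
exists (Num.sqrt k%:R) => L; rewrite ger0_norm ?sqrtr_ge0// ler_wsqrtr//.
rewrite -[leRHS]mulr1 -[X in X%:R * _](card_ord k) mulr_natl -sumr_const.
by apply: ler_sum => i _; rewrite cos2_le1.
Qed.

(* Since [w^2 - w^4 <= w] for [w >= 0], a bound from below on the second moment
   of the length and one from above on the fourth bound the mean from below. *)
Lemma mean_proj_norm_ge (k : nat) (e : 'I_k -> 'rV[R]_n.+1) : (0 < k)%N ->
  (forall i, dotp (e i) (e i) = 1) ->
  2 / 9 * Num.sqrt (k%:R / d) <= mean (proj_norm e).
Proof.
move=> k0 e1; have d0 : 0 < d by rewrite ltr0n.
set q := Num.sqrt _.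
have q0 : 0 < q by rewrite sqrtr_gt0 divr_gt0 ?ltr0n.
have qq : q ^+ 2 = k%:R / d by rewrite sqr_sqrtr// divr_ge0.
pose S L := \sum_(i < k) cos2 (e i) L.
have bS : bounded_meas S by apply: bounded_meas_sum => i; exact: bounded_meas_cos2.
have bg := bounded_meas_proj_norm e1.
have ES : mean S = q ^+ 2.
  rewrite /S mean_sum => [|i]; last exact: bounded_meas_cos2.
  rewrite qq (eq_bigr (fun=> d^-1)) => [|i _].
    by rewrite sumr_const card_ord mulr_natl.
  by apply: (mulfI (lt0r_neq0 d0)); rewrite mean_cos2// mulfV// lt0r_neq0.
(* Cauchy-Schwarz reduces S^2 to [k] times a sum of [k] fourth powers, each of mean at most 3 /
   d^2. *)
have ES2 : mean (fun L => S L * S L) <= 3 * q ^+ 4.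
  have b2 i : bounded_meas (fun L => cos2 (e i) L ^+ 2).
    by apply: (@bounded_measM (cos2 (e i)) (cos2 (e i))); exact: bounded_meas_cos2.
  apply: (@le_trans _ _ (mean (fun L => k%:R * \sum_(i < k) cos2 (e i) L ^+ 2))).
    apply: le_mean; first exact: bounded_measM.
      by apply: bounded_measM; [exact: bounded_meas_cst|exact: bounded_meas_sum].
    by move=> L; rewrite -expr2; exact: sqr_sum_le.
  rewrite meanZ; last exact: bounded_meas_sum.
  rewrite mean_sum// -(@ler_pM2l _ (d ^+ 2)) ?exprn_gt0//.
  rewrite (_ : d ^+ 2 * (3 * q ^+ 4) = k%:R * \sum_(i < k) 3); last first.
    rewrite (exprM q 2 2) qq sumr_const card_ord -[X in _ = _ * X]mulr_natl.
    by field; exact: lt0r_neq0.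
  rewrite mulrCA ler_pM2l ?ltr0n// mulr_sumr; apply: ler_sum => i _.
  exact: mean_cos2_sqr.
(* The scale [s] maximises s q^2 - 3 s^3 q^4, a lower bound for the mean; the maximum is q/3 - q/9 =
   2q/9. *)
pose s := (3 * q)^-1.
have s0 : 0 < s by rewrite invr_gt0 mulr_gt0.
have : mean (fun L => s * S L) <= mean (fun L => proj_norm e L + s ^+ 3 * (S L * S L)).
  apply: le_mean; first by apply: bounded_measM => //; exact: bounded_meas_cst.
    by apply: bounded_measD => //; apply: bounded_measM; [exact: bounded_meas_cst|exact: bounded_measM].
  move=> L; rewrite /S -sqr_proj_norm; set g := proj_norm e L.
  have g0 : 0 <= g by exact: sqrtr_ge0.
  rewrite -(@ler_pM2l _ s)//; set w := s * g.
  have w0 : 0 <= w by rewrite mulr_ge0// ltW.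
  have -> : s * (s * g ^+ 2) = w ^+ 2 by rewrite /w; ring.
  have -> : s * (g + s ^+ 3 * (g ^+ 2 * g ^+ 2)) = w + w ^+ 4 by rewrite /w; ring.
  have [w1|w1] := lerP w 1.
    by rewrite -[leLHS]addr0 lerD ?exprn_ge0// expr2 ler_piMr.
  by rewrite -[leLHS]add0r lerD// ler_weXn2l// ltW.
rewrite meanZ// meanD//; last by apply: bounded_measM; [exact: bounded_meas_cst|exact: bounded_measM].
rewrite meanZ; last exact: bounded_measM.
rewrite ES => h.
have s3 : s ^+ 3 * mean (fun L => S L * S L) <= s ^+ 3 * (3 * q ^+ 4).
  by rewrite ler_pM2l// exprn_gt0.
have E1 : s * q ^+ 2 = q / 3 by rewrite /s; field; rewrite lt0r_neq0.
have E2 : s ^+ 3 * (3 * q ^+ 4) = q / 9 by rewrite /s; field; rewrite lt0r_neq0.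
by move: h s3; rewrite E1 E2; move: (mean _) (_ * mean _) => a b; lra.
Qed.

End Moments.

(* No measurability is required: [L |-> Vol1 L (K|L)] is only ever bounded from
   below, which spares proving that it is measurable. *)
Lemma le_integral_nonmeasurable d (T : measurableType d) (R : realType)
    (mu : {measure set T -> \bar R}) (f g : T -> \bar R) :
  (forall x, 0 <= f x)%E -> (forall x, f x <= g x)%E ->
  (\int[mu]_x f x <= \int[mu]_x g x)%E.
Proof.
move=> f0 fg; have g0 x : (0 <= g x)%E by exact: le_trans (f0 x) (fg x).
rewrite !ge0_integralTE//; apply: le_ereal_sup => _ [h /= hf <-].
by exists h => // x; exact: le_trans (hf x) (fg x).
Qed.

(** * Width of a body that contains a lower-dimensional ball *)

Section Width.
Context {R : realType} {n : nat}.
Implicit Types (L : line R n) (K : set 'rV[R]_n.+1) (x : 'rV[R]_n.+1).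

Lemma orth_proj_image L K :
  [set t : R | orth_proj L K (t *: unit_dir L)] =
  (fun x => dotp x (unit_dir L)) @` K.
Proof.
have u1 := dotp_unit_dir L; apply/seteqP; split => t /=.
  move=> [_ [x Kx xt]]; exists x => //; have := xt _ (unit_dir_in L).
  by rewrite dotpDl dotpNl dotpZl u1 mulr1 => /eqP; rewrite subr_eq0 => /eqP.
move=> [x Kx <-]; split; first by rewrite memvZ// unit_dir_in.
exists x => // z /line_mem[a ->].
rewrite dotpZr dotpDl dotpNl (dotpZl _ (unit_dir L)) u1; ring.
Qed.

(** The shadow of the ball on [L] contains the interval of half-length [rho * g] around the image
    [c] of its centre; each point of it is reached by moving from [x] along the projection of
    [u]. *)
Lemma Vol1_ge L K (p x : 'rV[R]_n.+1) (V : {vspace 'rV[R]_n.+1}) (rho : R)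
    (k : nat) (e : 'I_k -> 'rV[R]_n.+1) :
  compact K -> 0 <= rho -> x - p \in V ->
  [set y | y - p \in V /\ enorm (y - x) <= rho] `<=` K ->
  (forall j, e j \in V) -> (forall i j, dotp (e i) (e j) = (i == j)%:R) ->
  ((2 * rho * proj_norm e L)%:E <= Vol1 L (orth_proj L K))%E.
Proof.
move=> cK rho0 xV BK eV ee; rewrite /Vol1 orth_proj_image.
set u := unit_dir L; set g := proj_norm e L; set c := dotp x u.
have g0 : 0 <= g by exact: sqrtr_ge0.
(* The shadow of [K] is compact, hence measurable, as monotonicity of the measure requires. *)
have mI : measurable ((fun x => dotp x u) @` K : set (measurableTypeR R)).
  apply: compact_measurable; apply: continuous_compact => //.
  exact/continuous_subspaceT/continuous_dotp.
pose I : set (measurableTypeR R) := `[c - rho * g, c + rho * g]%classic.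
have -> : (2 * rho * g)%:E = lebesgue_measure I.
  rewrite lebesgue_measure_itv/= lte_fin; case: ltP => h.
    by rewrite -EFinB; congr EFin; ring.
  by congr EFin; have : 0 <= rho * g := mulr_ge0 rho0 g0; lra.
apply: le_measure; rewrite ?inE//; first exact: measurable_itv.
move=> t; rewrite /I/= in_itv/= => /andP[t1 t2].
have gg : g ^+ 2 = \sum_j dotp u (e j) ^+ 2 by rewrite sqr_proj_norm.
(* If [g = 0], the interval is the single point [c], the image of the centre. *)
have [g00|gn0] := eqVneq g 0.
  exists x; last by move: t1 t2; rewrite g00 -/c; lra.
  by apply: BK; split => //; rewrite subrr /enorm dotp0l sqrtr0.
pose w := \sum_j dotp u (e j) *: e j.
have uw : dotp w u = g ^+ 2.
  rewrite gg dotp_suml; apply: eq_bigr => j _.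
  by rewrite dotpZl dotpC expr2.
have ww : dotp w w = g ^+ 2.
  rewrite gg {1}/w dotp_suml; apply: eq_bigr => j _.
  rewrite dotpZl dotp_sumr (bigD1 j)//= big1 => [|i ij].
    by rewrite dotpZr ee eqxx mulr1 addr0 expr2.
  by rewrite dotpZr ee eq_sym (negPf ij) mulr0.
(* As [w] is the projection of [u] onto the span of [e], <w, u> = |w|^2 = g^2. Hence <y, u> = t, and
   [y] lies at distance |t - c| / g <= rho from [x]. *)
pose y := x + ((t - c) / g ^+ 2) *: w.
exists y; last first.
  by rewrite /y dotpDl dotpZl uw -/c; field.
apply: BK; split.
  rewrite /y addrAC memvD// memvZ// memv_suml// => j _; exact: memvZ.
have gp : 0 < g by rewrite lt_neqAle eq_sym gn0.
have tc : `|t - c| <= rho * g by rewrite ler_norml; apply/andP; split; lra.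
rewrite /y addrC addKr /enorm dotpZl dotpZr ww.
have -> : (t - c) / g ^+ 2 * ((t - c) / g ^+ 2 * g ^+ 2) = ((t - c) / g) ^+ 2.
  by field.
by rewrite sqrtr_sqr normrM normfV (ger0_norm g0) ler_pdivrMr.
Qed.

End Width.

(** * Lower bound for [V1] from a ball inside a section *)

Section InnerRadius.
Context {R : realType} {n : nat} (mu : probability (line_space R n) R).
Hypothesis mu_rot : rotation_invariant mu.
Variable K : set 'rV[R]_n.+1.
Hypothesis cK : compact K.

Lemma V1_ge0 : (0 <= V1 mu K)%E.
Proof.
apply: mule_ge0; last by apply: integral_ge0 => L _; exact: measure_ge0.
rewrite lee_fin; apply: le_trans (V1_factor_ge n).
by rewrite mulr_ge0 ?sqrtr_ge0// ltW// Gamma_half_gt0.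
Qed.

(** The 4/9 is the 2 of the width 2 rho |Pu| times the 2/9 of [mean_proj_norm_ge]; the Gamma value
    comes from [V1_factor_ge]. *)
Definition V1_const : R := 4 / 9 * Gamma (1 + 1%:R / 2).

Lemma V1_const_gt0 : 0 < V1_const.
Proof. by rewrite mulr_gt0// Gamma_half_gt0. Qed.

Lemma V1_ge_ball (i : nat) (A : set 'rV[R]_n.+1) (rho : R) : (0 < i)%N ->
  affine_subspace i A -> 0 <= rho ->
  (exists2 x, A x & [set y | A y /\ enorm (y - x) <= rho] `<=` K `&` A) ->
  ((V1_const * Num.sqrt i%:R * rho)%:E <= V1 mu K)%E.
Proof.
move=> i0 [p [V [dV ->]]] rho0 [x xV BK].
have [e [eV ee]] : exists e : 'I_i -> 'rV[R]_n.+1, (forall j, e j \in V) /\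
    (forall j k, dotp (e j) (e k) = (j == k)%:R).
  by apply: exists_orthonormal; rewrite dV.
have e1 j : dotp (e j) (e j) = 1 by rewrite ee eqxx.
have d0 : (0 : R) < n.+1%:R by rewrite ltr0n.
have bg := bounded_meas_proj_norm e1.
have r20 : 0 <= 2 * rho by rewrite mulr_ge0.
have G0 := @Gamma_half_gt0 R 1.
have int_ge : ((2 * rho * mean mu (proj_norm e))%:E <=
    \int[mu]_(L in [set: line_space R n]) Vol1 L (orth_proj L K))%E.
  have := @le_integral_nonmeasurable _ _ R mu
    (fun L => (2 * rho * proj_norm e L)%:E) (fun L => Vol1 L (orth_proj L K)).
  rewrite -meanZ// => h.
  rewrite /mean /Rintegral fineK; last first.
    apply: integrable_fin_num => //; apply: bounded_meas_integrable.
    by apply: bounded_measM => //; exact: bounded_meas_cst.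
  apply: h => L; first by rewrite lee_fin mulr_ge0// sqrtr_ge0.
  apply: (@Vol1_ge _ _ L K p x V) => //.
  by move=> y /BK[].
apply: (@le_trans _ _ ((n.+1%:R * kappa R n.+1 / (kappa R 1 * kappa R n))%:E *
    (2 * rho * mean mu (proj_norm e))%:E)%E); last first.
  apply: lee_wpmul2l => //; rewrite lee_fin.
  apply: le_trans (V1_factor_ge n).
  by rewrite mulr_ge0 ?sqrtr_ge0// ltW.
rewrite -EFinM lee_fin.
(* The sqrt(n+1) of the normalising factor cancels the one in sqrt(i / (n+1)), so the bound is free
   of the ambient dimension. *)
apply: (@le_trans _ _ (Gamma (1 + 1%:R / 2) * Num.sqrt n.+1%:R *
    (2 * rho * (2 / 9 * Num.sqrt (i%:R / n.+1%:R))))).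
  have -> : Num.sqrt i%:R = Num.sqrt n.+1%:R * Num.sqrt (i%:R / n.+1%:R) :> R.
    by rewrite -sqrtrM// mulrCA mulfV ?mulr1 ?gt_eqF.
  by rewrite /V1_const le_eqVlt; apply/orP; left; apply/eqP; field.
apply: ler_pM; first by rewrite mulr_ge0 ?sqrtr_ge0// ltW.
- by rewrite !mulr_ge0// sqrtr_ge0.
- exact: V1_factor_ge.
- by apply: ler_wpM2l => //; exact: mean_proj_norm_ge.
Qed.

End InnerRadius.

(** * Suprema with their default values, the harmonic sum and the logarithm *)

Lemma sup_le_ge0 (R : realType) (S : set R) (b : R) : 0 <= b ->
  (forall x, S x -> x <= b) -> sup S <= b.
Proof.
move=> b0 Sb; have [S0|/set0P/negP/negPn/eqP ->] := pselect (S !=set0).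
  exact: ge_sup.
(* The empty set has [sup] 0, which is where [0 <= b] enters. *)
by rewrite sup0.
Qed.

Lemma sup_ge0 (R : realType) (S : set R) : (forall x, S x -> 0 <= x) -> 0 <= sup S.
Proof.
(* An empty or unbounded set has [sup] 0 by default. *)
move=> S0; have [hS|/sup_out ->//] := pselect (has_sup S).
have [[x Sx] _] := hS.
by rewrite (le_trans (S0 _ Sx))//; apply: sup_upper_bound.
Qed.

Lemma inradius_ge0 (R : realType) (d : nat) (L A : set 'rV[R]_d) :
  0 <= inradius L A.
Proof. by apply: sup_ge0 => x []. Qed.

Lemma inner_radius_ge0 (R : realType) (d i : nat) (K : set 'rV[R]_d) :
  0 <= inner_radius i K.
Proof. by apply: sup_ge0 => _ [L _ <-]; exact: inradius_ge0. Qed.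

(** With [a] and [b] the roots of m and m+1, the induction step is 1/b^2 <= 2 (b - a). It follows
    from 1 = (b - a)(b + a) and b + a <= 2b <= 2b^2. *)
Lemma harmonic_le_sqrt (R : realType) (m : nat) :
  \sum_(1 <= i < m.+1) (i%:R : R)^-1 <= 2 * Num.sqrt m%:R.
Proof.
elim: m => [|m ih]; first by rewrite big_geq// sqrtr0 mulr0.
rewrite big_nat_recr//=; apply: (le_trans (lerD ih (lexx _))).
set a := Num.sqrt m%:R; set b := Num.sqrt m.+1%:R.
have a0 : 0 <= a := sqrtr_ge0 _.
have b1 : 1 <= b by rewrite -[leLHS]sqrtr1 ler_wsqrtr// ler1n.
have bb : m.+1%:R = b ^+ 2 :> R by rewrite sqr_sqrtr.
have aa : a ^+ 2 = b ^+ 2 - 1 by rewrite -bb sqr_sqrtr// -natr1; ring.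
rewrite bb -lerBrDl -mulrBr -(@ler_pM2r _ (b ^+ 2)) ?exprn_gt0//; last by lra.
rewrite mulVf; last by rewrite expf_neq0// gt_eqF//; lra.
have ab : a <= b by rewrite -ler_sqr ?nnegrE; lra.
have -> : 2 * (b - a) * b ^+ 2 = (b - a) * (2 * b ^+ 2) by ring.
have E : 1 = (b - a) * (b + a) by rewrite -subr_sqr aa; ring.
rewrite [leLHS]E; apply: ler_wpM2l; first lra.
by nra.
Qed.

(** The logarithm is twice that of the square root, and ln x < x. *)
Lemma ln_le_sqrt (R : realType) (m : nat) : ln (m.+1%:R : R) <= 2 * Num.sqrt m.+1%:R.
Proof.
have s0 : (0 : R) < Num.sqrt m.+1%:R by rewrite sqrtr_gt0 ltr0n.
rewrite -{1}(@sqr_sqrtr R m.+1%:R)// lnXn// mulr2n mulr_natl mulr2n.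
have h : ln (Num.sqrt (m.+1%:R : R)) <= Num.sqrt m.+1%:R.
  by rewrite ltW// ln_sublinear.
exact: lerD.
Qed.

(** * Summation of the squared inner radii over all dimensions *)

Theorem corollary1 (R : realType) :
  exists2 c : R, 0 < c &
    forall (n : nat) (mu : probability (line_space R n) R)
           (K : set 'rV[R]_n.+1),
      rotation_invariant mu -> convex_body K ->
      ((c * Num.sqrt (ln n.+1%:R / n.+1%:R)
          * Num.sqrt (\sum_(1 <= i < n.+2) inner_radius i K ^+ 2))%:E
         <= V1 mu K)%E.
Proof.
have C0 := @V1_const_gt0 R.
exists (V1_const / 2); first by rewrite divr_gt0.
move=> n mu K mu_rot [_ cK _].
(* An infinite [V1] makes the bound trivial, so a real value [v] may be assumed. *)
have := V1_ge0 mu K; case E : (V1 mu K) => [v||]// v0; last by rewrite leey.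
rewrite lee_fin in v0.
have rle i : (0 < i)%N -> inner_radius i K ^+ 2 <= (v / V1_const) ^+ 2 * i%:R^-1.
  move=> i0; have si0 : (0 : R) < Num.sqrt i%:R by rewrite sqrtr_gt0 ltr0n.
  have -> : (v / V1_const) ^+ 2 * i%:R^-1 = (v / (V1_const * Num.sqrt i%:R)) ^+ 2.
    rewrite -[X in _ * X^-1](@sqr_sqrtr R)//.
    by field; rewrite !lt0r_neq0.
  have b0 : 0 <= v / (V1_const * Num.sqrt i%:R).
    by rewrite divr_ge0// mulr_ge0// ltW.
  rewrite ler_sqr ?nnegrE ?inner_radius_ge0//.
  (* Both suprema are unfolded, over the subspaces and over the radii, so that [V1_ge_ball] applies
     to a single ball. *)
  apply: sup_le_ge0 => // _ [A afA <-]; apply: sup_le_ge0 => // rho [rho0 H].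
  have := V1_ge_ball mu_rot cK i0 afA rho0 H; rewrite E lee_fin => h.
  rewrite ler_pdivlMr; last by rewrite mulr_gt0.
  by rewrite mulrC.
have d0 : (0 : R) < n.+1%:R by rewrite ltr0n.
have ln0 : 0 <= ln (n.+1%:R : R) by rewrite ln_ge0// ler1n.
rewrite lee_fin -mulrA -sqrtrM ?divr_ge0//.
(* The factor 2 inside the square is the root of the 4 that bounds ln d times the harmonic sum over
   d; the halved constant absorbs it, leaving exactly [v]. *)
apply: (@le_trans _ _ (V1_const / 2 * Num.sqrt ((2 * (v / V1_const)) ^+ 2))); last first.
  rewrite sqrtr_sqr ger0_norm ?mulr_ge0 ?invr_ge0// ?(ltW C0)//.
  by rewrite le_eqVlt; apply/orP; left; apply/eqP; field; rewrite lt0r_neq0.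
apply: ler_wpM2l; first by rewrite divr_ge0// ltW.
apply: ler_wsqrtr.
have S : \sum_(1 <= i < n.+2) inner_radius i K ^+ 2 <=
    (v / V1_const) ^+ 2 * (2 * Num.sqrt n.+1%:R).
  apply: (@le_trans _ _ (\sum_(1 <= i < n.+2) (v / V1_const) ^+ 2 * i%:R^-1)).
    rewrite big_nat_cond [leRHS]big_nat_cond.
    by apply: ler_sum => i /andP[/andP[i0 _] _]; exact: rle.
  by rewrite -mulr_sumr ler_wpM2l ?sqr_ge0// harmonic_le_sqrt.
apply: (le_trans (ler_wpM2l _ S)); first by rewrite divr_ge0.
apply: (@le_trans _ _ (2 * Num.sqrt n.+1%:R / n.+1%:R *
    ((v / V1_const) ^+ 2 * (2 * Num.sqrt n.+1%:R)))).
  apply: ler_wpM2r; first by rewrite mulr_ge0 ?sqr_ge0// mulr_ge0 ?sqrtr_ge0.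
  by rewrite ler_wpM2r ?invr_ge0// ln_le_sqrt.
rewrite le_eqVlt; apply/orP; left; apply/eqP.
have ss : Num.sqrt n.+1%:R ^+ 2 = n.+1%:R :> R by rewrite sqr_sqrtr.
have s0 : Num.sqrt n.+1%:R != 0 :> R by rewrite gt_eqF// sqrtr_gt0.
rewrite -[X in _ / X * _]ss; move: (Num.sqrt _) s0 => q q0.
by field; rewrite q0 lt0r_neq0.
Qed.
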